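(* Let $\bar M={}_fI\times_\sigma M$ be a doubly warped spacetime with metric $\bar g=-f^2dt^2\oplus\sigma^2g$ and let $\bar\zeta=h\partial_t+\zeta\in\mathfrak X(\bar M)$ be a vector field on $\bar M$. Then $(\bar M,\bar g,\bar\zeta,\lambda)$ is a Ricci soliton if (1) $(M,g,\zeta,\dot h)$ is a Ricci soliton on $M$, (2) $f=\sigma=1$, and (3) $\lambda=\dot h$.
   Context: $(M,g)$ is a Riemannian manifold, $I$ is an open connected interval with metric $-dt^2$, and $f:M\to(0,\infty)$, $\sigma:I\to(0,\infty)$ are smooth. The doubly warped spacetime ${}_fI\times_\sigma M$ is $I\times M$ with the metric $\bar g=-f^2dt^2\oplus\sigma^2g$; $h:I\to\mathbb R$ is smooth, $\zeta\in\mathfrak X(M)$ (identified with its lift), and a dot denotes $d/dt$. $(N,k,\zeta,\lambda)$ is a Ricci soliton if $\frac12\mathcal L_\zeta k+\mathrm{Ric}=\lambda k$, where $\mathrm{Ric}$ is the Ricci tensor of $(N,k)$ and $\lambda$ is a real constant. *)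

(* Defs.v *)
From HB Require Import structures.
From mathcomp Require Import all_boot all_order all_algebra.
From mathcomp Require Import all_classical all_reals all_analysis.
Import numFieldNormedType.Exports.
Import Order.TTheory GRing.Theory Num.Theory.

Set Implicit Arguments.
Unset Strict Implicit.
Unset Printing Implicit Defensive.

Local Open Scope classical_set_scope.
Local Open Scope ring_scope.

Section SmoothFunctions.
Context {R : realType} {n : nat}.
Implicit Types (U : set 'rV[R]_n) (F : 'rV[R]_n -> R).

Definition partial (i : 'I_n) F : 'rV[R]_n -> R :=
  fun x => 'D_(delta_mx 0 i) F x.

Fixpoint Ck_on (k : nat) U F : Prop :=
  (forall x, U x -> {for x, continuous F}) /\
  (if k is k'.+1 then
     forall i, (forall x, U x -> derivable F x (delta_mx 0 i)) /\
               Ck_on k' U (partial i F)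
   else True).

Definition smooth_on U F := forall k, Ck_on k U F.

End SmoothFunctions.

(* Vectors are rows, so the differential of [F] at [x] is [v |-> v *m jac F x]. *)
Definition jac {R : realType} {m n : nat} (F : 'rV[R]_m -> 'rV[R]_n)
    (x : 'rV[R]_m) : 'M[R]_(m, n) :=
  \matrix_(i, j) partial i (fun y => F y 0 j) x.

Record chart (R : realType) (n : nat) (T : topologicalType) := Chart {
  dom : set T;
  cod : set 'rV[R]_n;
  coord_of : T -> 'rV[R]_n;
  point_of : 'rV[R]_n -> T;
  dom_open : open dom;
  cod_open : open cod;
  coord_of_cod : forall p, dom p -> cod (coord_of p);
  point_of_dom : forall x, cod x -> dom (point_of x);
  coord_ofK : forall p, dom p -> point_of (coord_of p) = p;
  point_ofK : forall x, cod x -> coord_of (point_of x) = x;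
  coord_of_continuous : forall p, dom p -> {for p, continuous coord_of};
  point_of_continuous : forall x, cod x -> {for x, continuous point_of} }.

Section Transition.
Context {R : realType} {n : nat} {T : topologicalType}.
Implicit Types a b : chart R n T.

Definition overlap a b : set 'rV[R]_n :=
  [set x | cod a x /\ dom b (point_of a x)].

Definition transition a b : 'rV[R]_n -> 'rV[R]_n :=
  fun x => coord_of b (point_of a x).

End Transition.

Record manifold (R : realType) (n : nat) := Manifold {
  point_type :> topologicalType;
  atlas : Type;
  chart_at : atlas -> chart R n point_type;
  manifold_hausdorff : hausdorff_space point_type;
  manifold_second_countable : @second_countable point_type;
  atlas_cover : forall p : point_type, exists a, dom (chart_at a) p;
  atlas_smooth : forall a b j,
    smooth_on (overlap (chart_at a) (chart_at b))
      (fun x => transition (chart_at a) (chart_at b) x 0 j) }.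

Definition smooth_function {R : realType} {n : nat} (M : manifold R n)
    (f : M -> R) :=
  forall a : atlas M,
    smooth_on (cod (chart_at a)) (f \o point_of (chart_at a)).

(* Tensor fields are given by their components in each chart, as functions of
   the coordinates; values outside [cod (chart_at a)] are irrelevant. *)
Record vector_field (R : realType) (n : nat) (M : manifold R n) := VectorField {
  vf_comp :> atlas M -> 'rV[R]_n -> 'rV[R]_n;
  vf_smooth : forall a i,
    smooth_on (cod (chart_at a)) (fun x => vf_comp a x 0 i);
  vf_change : forall a b x, overlap (chart_at a) (chart_at b) x ->
    vf_comp b (transition (chart_at a) (chart_at b) x) =
    vf_comp a x *m jac (transition (chart_at a) (chart_at b)) x }.

(* Pseudo-Riemannian metrics; on a connected manifold the index of a
   nondegenerate metric is automatically constant. *)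
Record metric_tensor (R : realType) (n : nat) (M : manifold R n) := MetricTensor {
  g_comp :> atlas M -> 'rV[R]_n -> 'M[R]_n;
  g_smooth : forall a i j,
    smooth_on (cod (chart_at a)) (fun x => g_comp a x i j);
  g_sym : forall a x, cod (chart_at a) x -> (g_comp a x)^T = g_comp a x;
  g_nondegenerate : forall a x, cod (chart_at a) x -> g_comp a x \in unitmx;
  g_change : forall a b x, overlap (chart_at a) (chart_at b) x ->
    g_comp a x = jac (transition (chart_at a) (chart_at b)) x
      *m g_comp b (transition (chart_at a) (chart_at b) x)
      *m (jac (transition (chart_at a) (chart_at b)) x)^T }.

Definition riemannian {R : realType} {n : nat} {M : manifold R n}
    (g : metric_tensor M) :=
  forall (a : atlas M) x (v : 'rV[R]_n), cod (chart_at a) x -> v != 0 ->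
    0 < (v *m g a x *m v^T) 0 0.

Section LocalGeometry.
Context {R : realType} {n : nat}.
Implicit Types (G : 'rV[R]_n -> 'M[R]_n) (X : 'rV[R]_n -> 'rV[R]_n).

(* Gamma^k_ij *)
Definition christoffel G (k i j : 'I_n) : 'rV[R]_n -> R := fun x =>
  2^-1 * \sum_l invmx (G x) k l *
    (partial i (fun y => G y j l) x + partial j (fun y => G y i l) x
     - partial l (fun y => G y i j) x).

(* [riemann G l k i j] is R^l_kij, where R(d_i, d_j) d_k = R^l_kij d_l and
   R(X, Y) = [nabla_X, nabla_Y] - nabla_[X, Y]. *)
Definition riemann G (l k i j : 'I_n) : 'rV[R]_n -> R := fun x =>
  partial i (christoffel G l j k) x - partial j (christoffel G l i k) x
  + \sum_m (christoffel G l i m x * christoffel G m j k x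
            - christoffel G l j m x * christoffel G m i k x).

(* Ric(Y, Z) is the trace of X |-> R(X, Y) Z. *)
Definition ricci G : 'rV[R]_n -> 'M[R]_n := fun x =>
  \matrix_(j, k) \sum_i riemann G i k i j x.

Definition lie_derivative X G : 'rV[R]_n -> 'M[R]_n := fun x =>
  \matrix_(i, j) \sum_k
    (X x 0 k * partial k (fun y => G y i j) x
     + G x k j * partial i (fun y => X y 0 k) x
     + G x i k * partial j (fun y => X y 0 k) x).

End LocalGeometry.

Definition ricci_soliton {R : realType} {n : nat} {N : manifold R n}
    (k : metric_tensor N) (zeta : vector_field N) (lambda : R) :=
  forall (a : atlas N) x, cod (chart_at a) x ->
    2^-1 *: lie_derivative (zeta a) (k a) x + ricci (k a) x = lambda *: k a x.

Record open_interval (R : realType) := OpenInterval {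
  interval_set : set R;
  interval_set_open : open interval_set;
  interval_set_convex : is_interval interval_set;
  interval_set_neq0 : interval_set !=set0 }.

(* Functions on [I] are total functions whose values outside [I] are
   irrelevant. *)
Definition smooth_on_interval {R : realType} (I : open_interval R)
    (s : R -> R) :=
  forall k t, interval_set I t -> derivable (derive1n k s) t 1.

Record smooth_fun_on (R : realType) (I : open_interval R) := SmoothFunOn {
  sfun :> R -> R;
  sfun_smooth : smooth_on_interval I sfun }.

Record pos_smooth_fun_on (R : realType) (I : open_interval R) := PosSmoothFunOn {
  psfun :> R -> R;
  psfun_smooth : smooth_on_interval I psfun;
  psfun_gt0 : forall t, interval_set I t -> 0 < psfun t }.

Record pos_smooth_fun (R : realType) (n : nat) (M : manifold R n) := PosSmoothFun {
  pfun :> M -> R;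
  pfun_smooth : smooth_function pfun;
  pfun_gt0 : forall p, 0 < pfun p }.

Section CkTheory.
Context {R : realType} {n : nat}.
Implicit Types (U : set 'rV[R]_n) (F G : 'rV[R]_n -> R).

Lemma Ck_onW k U F : Ck_on k.+1 U F -> Ck_on k U F.
Proof.
elim: k F => [|k IH] F [cF dF]; first by split.
split=> // i; have [dFi /IH] := dF i; by split.
Qed.

Lemma near_open_eq U F G x : open U -> {in U, F =1 G} -> U x ->
  \near x, F x = G x.
Proof.
move=> oU FG Ux; near=> y; apply: FG; rewrite inE; near: y.
exact: open_nbhs_nbhs.
Unshelve. all: by end_near. Qed.

Lemma eq_cts_on U F G x : open U -> {in U, F =1 G} -> U x ->
  {for x, continuous F} -> {for x, continuous G}.
Proof.
move=> oU FG Ux cF; have E : F x = G x by apply: FG; rewrite inE.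
move=> A nA; move: nA; rewrite -E => /cF nFA.
have nFG : nbhs x [set y | F y = G y] by exact: near_open_eq oU FG Ux.
change (nbhs x (F @^-1` A)) in nFA; change (nbhs x (G @^-1` A)).
apply: filterS (filterI nFA nFG) => y [AFy FGy].
by rewrite /preimage /= -FGy.
Qed.

Lemma eq_Ck_on k U F G : open U -> {in U, F =1 G} ->
  Ck_on k U F -> Ck_on k U G.
Proof.
move=> oU; elim: k F G => [|k IH] F G FG [cF dF].
  split=> // x Ux; exact: eq_cts_on oU FG Ux (cF x Ux).
split.
  move=> x Ux; exact: eq_cts_on oU FG Ux (cF x Ux).
move=> i; have [dFi CFi] := dF i; split.
  by move=> x Ux; apply: near_eq_derivable (dFi x Ux); exact: near_open_eq oU FG Ux.
apply: IH CFi => x; rewrite inE => Ux.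
by apply: near_eq_derive; exact: near_open_eq oU FG Ux.
Qed.

Lemma Ck_on_cst k U (c : R) : Ck_on k U (fun=> c).
Proof.
elim: k c => [|k IH] c; split=> //; try by move=> x _; exact: cst_continuous.
move=> i; split=> [x _|]; first exact: derivable_cst.
rewrite (_ : partial _ _ = fun=> 0); first exact: IH.
by apply/funext => x; rewrite /partial derive_cst.
Qed.

Lemma Ck_onD k U F G : open U -> Ck_on k U F -> Ck_on k U G ->
  Ck_on k U (fun x => F x + G x).
Proof.
move=> oU; elim: k F G => [|k IH] F G [cF dF] [cG dG].
  by split=> // x Ux; apply: (@continuousD _ _ _ F G x); [exact: cF|exact: cG].
split=> [x Ux|i]; first by apply: (@continuousD _ _ _ F G x); [exact: cF|exact: cG].
have [dFi CFi] := dF i; have [dGi CGi] := dG i; split=> [x Ux|].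
  by apply: derivableD; [exact: dFi|exact: dGi].
apply: (eq_Ck_on oU _ (IH _ _ CFi CGi)) => x; rewrite inE => Ux.
by rewrite /partial deriveD//; [exact: dFi|exact: dGi].
Qed.

Lemma Ck_onM k U F G : open U -> Ck_on k U F -> Ck_on k U G ->
  Ck_on k U (fun x => F x * G x).
Proof.
move=> oU; elim: k F G => [|k IH] F G CF CG.
  by case: CF CG => [cF _] [cG _]; split=> // x Ux; apply: (@continuousM _ _ F G x); [exact: cF|exact: cG].
have [cF dF] := CF; have [cG dG] := CG.
split=> [x Ux|i]; first by apply: (@continuousM _ _ F G x); [exact: cF|exact: cG].
have [dFi CFi] := dF i; have [dGi CGi] := dG i; split=> [x Ux|].
  by apply: derivableM; [exact: dFi|exact: dGi].
have C : Ck_on k U (fun x => F x * partial i G x + G x * partial i F x).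
  by apply: Ck_onD => //; apply: IH => //; exact: Ck_onW.
apply: (eq_Ck_on oU _ C) => x; rewrite inE => Ux.
by rewrite /partial deriveM//; [exact: dFi|exact: dGi].
Qed.

Lemma smooth_on_cst U (c : R) : smooth_on U (fun=> c).
Proof. by move=> k; exact: Ck_on_cst. Qed.

Lemma smooth_onM U F G : open U -> smooth_on U F -> smooth_on U G ->
  smooth_on U (fun x => F x * G x).
Proof. by move=> oU sF sG k; exact: Ck_onM. Qed.

Lemma smooth_onN U F : open U -> smooth_on U F -> smooth_on U (fun x => - F x).
Proof.
move=> oU sF; rewrite (_ : (fun x => _) = fun x => -1 * F x).
  by apply: smooth_onM => //; exact: smooth_on_cst.
by apply/funext => x; rewrite mulN1r.
Qed.

Lemma eq_smooth_on U F G : open U -> {in U, F =1 G} ->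
  smooth_on U F -> smooth_on U G.
Proof. by move=> oU FG sF k; exact: eq_Ck_on (sF k). Qed.

Lemma smooth_on_sub U V F : V `<=` U -> smooth_on U F -> smooth_on V F.
Proof.
move=> VU sF k; move: (sF k) => {sF}; elim: k F => [|k IH] F [cF dF].
  by split=> // x /VU; exact: cF.
split=> [x /VU|i]; first exact: cF.
by have [dFi /IH CFi] := dF i; split=> // x /VU; exact: dFi.
Qed.

End CkTheory.

Lemma derive_comp_affine (R : realType) (V V' W : normedModType R)
    (F : V' -> W) (L : V -> V') (x v : V) (w : V') :
  (forall h : R, L (h *: v + x) = h *: w + L x) ->
  (derivable (F \o L) x v = derivable F (L x) w) *
  ('D_v (F \o L) x = 'D_w F (L x)).
Proof.
move=> LE; rewrite /derivable /derive.
rewrite (_ : (fun h => h^-1 *: ((F \o L \o shift x) (h *: v) - (F \o L) x)) =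
  (fun h => h^-1 *: ((F \o shift (L x)) (h *: w) - F (L x)))) //.
by apply/funext => h /=; rewrite LE.
Qed.

Section TimeSpace.
Context {R : realType} {n : nat}.
Implicit Type x : 'rV[R]_(1 + n).

Definition tcoord x : R := x 0 (lshift n 0).
Definition xcoord x : 'rV[R]_n := rsubmx x.

Lemma tcoord_continuous : continuous tcoord.
Proof. exact: coord_continuous. Qed.

Lemma cts_rV (T : topologicalType) m (F : T -> 'rV[R]_m) (p : T) :
  (forall j, {for p, continuous (fun q => F q 0 j)}) -> {for p, continuous F}.
Proof.
move=> cF A [P nP PA].
have : \forall q \near p, forall j, P 0 j (F q 0 j).
  by apply: filter_forall => j; exact: (cF j _ (nP 0 j)).
by apply: filterS => q H; apply: PA => i j; rewrite ord1.
Qed.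

Lemma xcoord_continuous : continuous xcoord.
Proof.
move=> x; apply: cts_rV => j.
rewrite (_ : (fun q => _) = fun q : 'rV_(1 + n) => q 0 (rshift 1 j)).
  exact: coord_continuous.
by apply/funext => q; rewrite !mxE.
Qed.

Lemma time_delta (i : 'I_(1 + n)) x (h : R) :
  tcoord (h *: delta_mx 0 i + x) = h *: (i == lshift n 0)%:R + tcoord x.
Proof. by rewrite /tcoord !mxE eqxx /= eq_sym. Qed.

Lemma space_deltal x (h : R) :
  xcoord (h *: delta_mx 0 (lshift n 0) + x) = h *: 0 + xcoord x.
Proof.
by apply/rowP => j; rewrite !mxE eq_rlshift andbF !mulr0.
Qed.

Lemma space_deltar i x (h : R) :
  xcoord (h *: delta_mx 0 (rshift 1 i) + x) = h *: delta_mx 0 i + xcoord x.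
Proof. by apply/rowP => j; rewrite !mxE (eq_rshift 1 j i). Qed.

Lemma partial_space_l (F : 'rV[R]_n -> R) x :
  derivable (F \o xcoord) x (delta_mx 0 (lshift n 0)) /\
  partial (lshift n 0) (F \o xcoord) x = 0.
Proof.
have E := derive_comp_affine F (space_deltal x).
by rewrite /partial !E; split; [exact: derivable0|rewrite derive0].
Qed.

Lemma partial_space_r (F : 'rV[R]_n -> R) i x :
  (derivable (F \o xcoord) x (delta_mx 0 (rshift 1 i)) =
     derivable F (xcoord x) (delta_mx 0 i)) *
  (partial (rshift 1 i) (F \o xcoord) x = partial i F (xcoord x)).
Proof.
have E := derive_comp_affine F (space_deltar i x).
by rewrite /partial !E.
Qed.

Lemma partial_time_l (s : R -> R) x :
  (derivable (s \o tcoord) x (delta_mx 0 (lshift n 0)) = derivable s (tcoord x) 1) *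
  (partial (lshift n 0) (s \o tcoord) x = derive1 s (tcoord x)).
Proof.
have E := derive_comp_affine s (time_delta (lshift n 0) x).
by rewrite /partial !E eqxx derive1E.
Qed.

Lemma partial_time_r (s : R -> R) i x :
  derivable (s \o tcoord) x (delta_mx 0 (rshift 1 i)) /\
  partial (rshift 1 i) (s \o tcoord) x = 0.
Proof.
have E := derive_comp_affine s (time_delta (rshift 1 i) x).
rewrite /partial !E eq_rlshift.
by split; [exact: derivable0|rewrite derive0].
Qed.

Lemma Ck_on_space k (U : set 'rV[R]_n) F :
  Ck_on k U F -> Ck_on k (xcoord @^-1` U) (F \o xcoord).
Proof.
elim: k F => [|k IH] F [cF dF].
  split=> // x Ux; apply: continuous_comp; first exact: xcoord_continuous.
  exact: cF.
split=> [x Ux|i].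
  apply: continuous_comp; first exact: xcoord_continuous.
  exact: cF.
case: (split_ordP i) => j ->{i}.
- rewrite ord1; split=> [x _|]; first by case: (partial_space_l F x).
  rewrite (_ : partial _ _ = fun=> 0); first exact: Ck_on_cst.
  by apply/funext => x; case: (partial_space_l F x).
- have [dFj CFj] := dF j; split=> [x Ux|].
    by rewrite partial_space_r; exact: dFj.
  rewrite (_ : partial _ _ = partial j F \o xcoord); first exact: IH.
  by apply/funext => x; rewrite partial_space_r.
Qed.

Lemma smooth_on_space (U : set 'rV[R]_n) F :
  smooth_on U F -> smooth_on (xcoord @^-1` U) (F \o xcoord).
Proof. by move=> sF k; exact: Ck_on_space. Qed.

Lemma smooth_on_time (I : open_interval R) s :
  smooth_on_interval I s -> smooth_on (tcoord @^-1` interval_set I) (s \o tcoord).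
Proof.
move=> + k; elim: k s => [|k IH] s ss.
  split=> // x Ix; apply: continuous_comp; first exact: tcoord_continuous.
  by apply/differentiable_continuous/derivable1_diffP; exact: (ss 0%N).
split=> [x Ix|i].
  apply: continuous_comp; first exact: tcoord_continuous.
  by apply/differentiable_continuous/derivable1_diffP; exact: (ss 0%N).
case: (split_ordP i) => j ->{i}.
- rewrite ord1; split=> [x Ix|].
    by rewrite partial_time_l; exact: (ss 0%N).
  rewrite (_ : partial _ _ = derive1 s \o tcoord).
    by apply: IH => m t It; move: (ss m.+1 t It); rewrite /derive1n iterSr.
  by apply/funext => x; rewrite partial_time_l.
- split=> [x _|]; first by case: (partial_time_r s j x).
  rewrite (_ : partial _ _ = fun=> 0); first exact: Ck_on_cst.
  by apply/funext => x; case: (partial_time_r s j x).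
Qed.

Lemma smooth_on_time_id (U : set 'rV[R]_(1 + n)) : smooth_on U tcoord.
Proof.
have H : smooth_on_interval (@OpenInterval R setT openT
    (fun _ _ _ _ _ _ => Logic.I) (ex_intro _ 0 Logic.I)) id.
  move=> k t _; case: k => [|k]; first exact: derivable_id.
  have E : forall m, derive1n m.+1 (id : R -> R) = fun=> (m == 0%N)%:R.
    elim=> [|m IH].
      by apply/funext => u; rewrite derive1n1 derive1E derive_id.
    rewrite /derive1n iterS -/(derive1n _ _) IH; apply/funext => u.
    by rewrite derive1E derive_cst.
  by rewrite E; exact: derivable_cst.
apply: (@smooth_on_sub R (1 + n) setT) => //.
exact: (smooth_on_time H).
Qed.

End TimeSpace.

Section Topology.

Lemma second_countable_initial (S : choiceType) (T : topologicalType)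
    (f : S -> T) :
  @second_countable T -> @second_countable (initial_topology f).
Proof.
move=> [B cB [oB bB]]; exists [set f @^-1` A | A in B].
  exact: sub_countable (card_image_le _ _) cB.
split=> [_ [A BA <-]|x].
  by exists A => //; exact: oB.
move=> V; rewrite nbhsE => -[W [[A oA fA] Wx] WV].
have nA : nbhs (f x) A.
  by apply: open_nbhs_nbhs; split => //; rewrite -fA in Wx.
have [C [BC Cfx] CA] := bB (f x) A nA.
exists (f @^-1` C); first by split => //; exists C.
by move=> y Cy; apply: WV; rewrite -fA; exact: CA.
Qed.

Lemma second_countable_prod (S T : topologicalType) :
  @second_countable S -> @second_countable T -> @second_countable (S * T)%type.
Proof.
move=> [B cB [oB bB]] [C cC [oC bC]].
exists [set A.1 `*` A.2 | A in B `*` C].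
  exact: sub_countable (card_image_le _ _) (countableX cB cC).
split=> [_ [[A D] [BA CD] <-]|[x y]].
  rewrite openE => -[x y] [/= Ax Dy]; exists (A, D) => //; split.
    by apply: open_nbhs_nbhs; split=> //; exact: oB.
  by apply: open_nbhs_nbhs; split=> //; exact: oC.
move=> V [[A D] [/= nA nD] ADV].
have [A' [BA' A'x] AA'] := bB x A nA.
have [D' [CD' D'y] DD'] := bC y D nD.
exists (A' `*` D'); first by split=> //; exists (A', D').
by move=> [u v] [/= A'u D'v]; apply: ADV; split; [exact: AA'|exact: DD'].
Qed.

Lemma hausdorff_prod (S T : topologicalType) :
  hausdorff_space S -> hausdorff_space T -> hausdorff_space (S * T)%type.
Proof.
move=> hS hT [x y] [u v] xyuv; congr (_, _).
- apply: hS => A B nA nB.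
  have [||[a b] [/= [Aa _] [Ba _]]] := xyuv (A `*` setT) (B `*` setT).
  + by exists (A, setT) => //; split => //; exact: filterT.
  + by exists (B, setT) => //; split => //; exact: filterT.
  + by exists a.
- apply: hT => A B nA nB.
  have [||[a b] [/= [_ Aa] [_ Ba]]] := xyuv (setT `*` A) (setT `*` B).
  + by exists (setT, A) => //; split => //; exact: filterT.
  + by exists (setT, B) => //; split => //; exact: filterT.
  + by exists b.
Qed.

Lemma hausdorff_set_type (T : topologicalType) (A : set T) :
  hausdorff_space T -> hausdorff_space A.
Proof.
move=> hT p q pq; apply: val_inj; apply: hT => C D nC nD.
have cv : continuous (set_val : A -> T) by exact: initial_continuous.
have [z [Cz Dz]] := pq _ _ (cv p _ nC) (cv q _ nD).
by exists (set_val z).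
Qed.

Lemma second_countable_R (R : realType) : @second_countable R.
Proof.
pose B := [set ball (ratr q.1 : R) (ratr q.2 : R) | q in [set: rat * rat]].
exists B.
  apply: sub_countable (card_image_le _ _) _; exact: countableP.
split=> [_ [q _ <-]|x V /nbhs_ballP[e /= e0 xV]].
  exact: ball_open.
have [r] : exists r : rat, ratr r \in `]0, e / 2[%R :> Prop.
  by apply: rat_in_itvoo; rewrite divr_gt0.
rewrite in_itv /= => /andP[r0 re].
have [q] : exists q : rat, ratr q \in `]x - ratr r, x + ratr r[%R :> Prop.
  by apply: rat_in_itvoo; rewrite ltrBlDr -addrA ltrDl addr_gt0.
rewrite in_itv /= => /andP[q1 q2].
have xq : `|ratr q - x| < ratr r by rewrite ltr_distl q1.
exists (ball (ratr q : R) (ratr r : R)).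
  by split; [exists (q, r)|].
move=> y; rewrite /ball /= => qy; apply: xV; rewrite /ball /=.
have -> : x - y = (x - ratr q) + (ratr q - y) by rewrite addrA subrK.
apply: le_lt_trans (ler_normD _ _) _.
rewrite distrC [e]splitr; apply: ltrD; first exact: lt_trans re.
exact: lt_trans re.
Qed.

End Topology.

Section Product.
Context {R : realType} {n : nat} (I : open_interval R) (M : manifold R n).

(* Only provides a default value for [to_interval] outside [I]. *)
Definition interval_point : interval_set I :=
  exist (fun t => t \in interval_set I) _ (mem_set (svalP (cid (interval_set_neq0 I)))).

Definition to_interval (t : R) : interval_set I := insubd interval_point t.

Lemma to_intervalK t : interval_set I t -> \val (to_interval t) = t.
Proof. by move=> It; rewrite val_insubd mem_set. Qed.

Lemma val_interval (t : interval_set I) : interval_set I (\val t).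
Proof. exact: set_mem (valP t). Qed.

Lemma val_to_interval (t : interval_set I) : to_interval (\val t) = t.
Proof. by apply: val_inj; rewrite to_intervalK//; exact: val_interval. Qed.

Lemma to_interval_continuous t : interval_set I t ->
  {for t, continuous to_interval}.
Proof.
move=> It V; rewrite nbhsE => -[W [[A oA fA] Wx] WV].
have At : A t by move: Wx; rewrite -fA /= set_valE /= to_intervalK.
have : nbhs t (A `&` interval_set I).
  by apply: open_nbhs_nbhs; split => //; apply: openI => //; exact: interval_set_open.
apply: filterS => s [As Is]; apply: WV.
by rewrite -fA /= set_valE /= to_intervalK.
Qed.

Section ProductChart.
Variable a : chart R n M.

Definition pdom : set (interval_set I * M) := [set p | dom a p.2].
Definition pcod : set 'rV[R]_(1 + n) :=
  [set x | interval_set I (tcoord x) /\ cod a (xcoord x)].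
Definition pcoord (p : interval_set I * M) : 'rV[R]_(1 + n) :=
  row_mx (\val p.1)%:M (coord_of a p.2).
Definition ppoint (x : 'rV[R]_(1 + n)) : interval_set I * M :=
  (to_interval (tcoord x), point_of a (xcoord x)).

Lemma time_row t (y : 'rV[R]_n) : tcoord (row_mx t%:M y) = t.
Proof. by rewrite /tcoord row_mxEl mxE. Qed.
Lemma space_row t (y : 'rV[R]_n) : xcoord (row_mx t%:M y) = y.
Proof. exact: row_mxKr. Qed.

Lemma row_time_space (x : 'rV[R]_(1 + n)) : row_mx (tcoord x)%:M (xcoord x) = x.
Proof.
rewrite -[RHS]hsubmxK; congr row_mx; apply/rowP => j; rewrite ord1 !mxE.
by rewrite eqxx.
Qed.

Lemma pdom_open : open pdom.
Proof.
apply: (@open_comp _ _ snd (dom a)); last exact: dom_open.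
by move=> p _; exact: cvg_snd.
Qed.

Lemma pcod_open : open pcod.
Proof.
apply: openI.
  apply: (@open_comp _ _ tcoord); last exact: interval_set_open.
  by move=> x _; exact: tcoord_continuous.
apply: (@open_comp _ _ xcoord); last exact: cod_open.
by move=> x _; exact: xcoord_continuous.
Qed.

Lemma pcoord_cod p : pdom p -> pcod (pcoord p).
Proof.
move=> dp; split; rewrite /pcoord ?time_row ?space_row.
  exact: val_interval.
exact: coord_of_cod.
Qed.

Lemma ppoint_dom x : pcod x -> pdom (ppoint x).
Proof. by case=> _ /point_of_dom. Qed.

Lemma pcoordK p : pdom p -> ppoint (pcoord p) = p.
Proof.
case: p => t q dq; rewrite /ppoint /pcoord time_row space_row /=.
by rewrite val_to_interval coord_ofK.
Qed.

Lemma ppointK x : pcod x -> pcoord (ppoint x) = x.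
Proof.
case=> It cx; rewrite /pcoord /= to_intervalK// point_ofK//.
exact: row_time_space.
Qed.

Lemma pcoord_continuous p : pdom p -> {for p, continuous pcoord}.
Proof.
move=> dp; apply: cts_rV => j; case: (split_ordP j) => i ->.
- rewrite (_ : (fun q => _) = set_val \o fst).
    apply: (@continuous_comp _ _ _ fst set_val); first exact: cvg_fst.
    exact: (@initial_continuous (interval_set I) R set_val).
  by apply/funext => q; rewrite /pcoord row_mxEl ord1 mxE eqxx set_valE.
- rewrite (_ : (fun q => _) = (fun y : 'rV[R]_n => y 0 i) \o (coord_of a \o snd)).
    apply: (@continuous_comp _ _ _ (coord_of a \o snd)); last exact: coord_continuous.
    apply: (@continuous_comp _ _ _ snd (coord_of a)); first exact: cvg_snd.
    exact: coord_of_continuous.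
  by apply/funext => q; rewrite /pcoord row_mxEr.
Qed.

Lemma ppoint_continuous x : pcod x -> {for x, continuous ppoint}.
Proof.
case=> It cx A [[B C] [/= nB nC] BCA].
have cB : {for x, continuous (to_interval \o tcoord)}.
  apply: (@continuous_comp _ _ _ tcoord to_interval); first exact: tcoord_continuous.
  exact: to_interval_continuous.
have cC : {for x, continuous (point_of a \o xcoord)}.
  apply: (@continuous_comp _ _ _ xcoord (point_of a)); first exact: xcoord_continuous.
  exact: point_of_continuous.
change (nbhs x (ppoint @^-1` A)).
have nBC : nbhs x ((to_interval \o tcoord) @^-1` B `&`
                   (point_of a \o xcoord) @^-1` C).
  by apply: filterI; [exact: (cB _ nB)|exact: (cC _ nC)].
apply: filterS nBC => y [By Cy]; exact: BCA.
Qed.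

Definition product_chart : chart R (1 + n) (interval_set I * M)%type :=
  Chart pdom_open pcod_open pcoord_cod ppoint_dom pcoordK ppointK
    pcoord_continuous ppoint_continuous.

End ProductChart.

Lemma overlap_open (T : topologicalType) m (a b : chart R m T) :
  open (overlap a b).
Proof.
rewrite openE => x [cx bx].
have : nbhs x (cod a `&` point_of a @^-1` dom b).
  apply: filterI; first by apply: open_nbhs_nbhs; split=> //; exact: cod_open.
  apply: (point_of_continuous cx).
  by apply: open_nbhs_nbhs; split=> //; exact: dom_open.
exact.
Qed.

Lemma overlap_product (a b : chart R n M) :
  overlap (product_chart a) (product_chart b) =
  [set x | interval_set I (tcoord x) /\ overlap a b (xcoord x)].
Proof.
apply/seteqP; split=> x /=; first by case=> -[].
by case=> It [ca db]; split.
Qed.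

Lemma transition_product (a b : chart R n M) x : interval_set I (tcoord x) ->
  transition (product_chart a) (product_chart b) x =
  row_mx (tcoord x)%:M (transition a b (xcoord x)).
Proof. by move=> It; rewrite /transition /= /pcoord /= to_intervalK. Qed.

Lemma product_smooth (a b : atlas M) j :
  smooth_on (overlap (product_chart (chart_at a)) (product_chart (chart_at b)))
    (fun x => transition (product_chart (chart_at a))
                         (product_chart (chart_at b)) x 0 j).
Proof.
set O := overlap _ _; have oO : open O by exact: overlap_open.
case: (split_ordP j) => i ->{j}.
- apply: (@eq_smooth_on _ _ O tcoord _ oO); last exact: smooth_on_time_id.
  move=> x; rewrite inE /O overlap_product => -[It _].
  by rewrite transition_product// row_mxEl ord1 mxE eqxx.
- have S := smooth_on_space (@atlas_smooth _ _ M a b i).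
  apply: (@eq_smooth_on _ _ O _ _ oO _ (smooth_on_sub _ S)).
    by move=> x; rewrite inE /O overlap_product => -[It _];
      rewrite transition_product// row_mxEr.
  by move=> x; rewrite /O overlap_product => -[_].
Qed.

Lemma product_cover (p : interval_set I * M) :
  exists a, dom (product_chart (chart_at a)) p.
Proof. exact: (@atlas_cover _ _ M p.2). Qed.

Definition interval_times : manifold R (1 + n) :=
  @Manifold R (1 + n) (interval_set I * M)%type (atlas M)
    (fun a => product_chart (chart_at a))
    (hausdorff_prod (hausdorff_set_type (@Rhausdorff R))
                    (@manifold_hausdorff _ _ M))
    (second_countable_prod (second_countable_initial set_val (@second_countable_R R))
                           (@manifold_second_countable _ _ M))
    product_cover product_smooth.

End Product.

Section DoublyWarped.
Context {R : realType} {n : nat} {I : open_interval R} {M : manifold R n}.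
Implicit Types (a b : atlas M) (x : 'rV[R]_(1 + n)).

Let P := interval_times I M.

Lemma jac_transition_product (a b : chart R n M) x :
  overlap (product_chart I a) (product_chart I b) x ->
  jac (transition (product_chart I a) (product_chart I b)) x =
  block_mx 1%:M 0 0 (jac (transition a b) (xcoord x)).
Proof.
set O := overlap _ _ => Ox; have oO : open O by exact: overlap_open.
have H j : partial j (fun y => tcoord y) x = (j == lshift n 0)%:R.
  case: (split_ordP j) => k ->{j}.
    by have := (partial_time_l id x).2; rewrite ord1 eqxx derive1E derive_id.
  by have [_] := partial_time_r id k x; rewrite eq_rlshift.
have nearO (F G : 'rV[R]_(1 + n) -> R) j : (forall y, O y -> F y = G y) ->
    partial j F x = partial j G x.
  move=> FG; apply: near_eq_derive; apply: (near_open_eq oO) => // y.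
  by rewrite inE; exact: FG.
apply/matrixP => i j; rewrite [LHS]mxE.
case: (split_ordP j) => k ->{j}.
- rewrite (nearO _ tcoord); last first.
    move=> y; rewrite /O overlap_product => -[It _].
    by rewrite transition_product// row_mxEl ord1 mxE eqxx.
  rewrite H; case: (split_ordP i) => l ->{i}.
    by rewrite block_mxEul !ord1 mxE eqxx.
  by rewrite block_mxEdl eq_rlshift mxE.
- rewrite (nearO _ ((fun y => transition a b y 0 k) \o xcoord)); last first.
    move=> y; rewrite /O overlap_product => -[It _].
    by rewrite transition_product// row_mxEr.
  case: (split_ordP i) => l ->{i}.
    have [_] := partial_space_l (fun y => transition a b y 0 k) x.
    by rewrite ord1 => ->; rewrite block_mxEur mxE.
  by rewrite partial_space_r block_mxEdr mxE.
Qed.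

Section Metric.
Variables (f : pos_smooth_fun M) (s : pos_smooth_fun_on I) (g : metric_tensor M).

(* [- f^2 dt^2 + s^2 g] in the chart [(t, y)] of [I * M] built from a chart [y]
   of [M]. *)
Definition warped_comp a x : 'M[R]_(1 + n) :=
  block_mx (- f (point_of (chart_at a) (xcoord x)) ^+ 2)%:M 0
           0 (s (tcoord x) ^+ 2 *: g a (xcoord x)).

Lemma warped_smooth a i j :
  smooth_on (cod (product_chart I (chart_at a)))
    (fun x => warped_comp a x i j).
Proof.
set C := cod _; have oC : open C by exact: pcod_open.
case: (split_ordP i) => k ->{i}; case: (split_ordP j) => l ->{j}.
- rewrite (_ : (fun x => _) = fun x => - (
      ((f \o point_of (chart_at a)) \o xcoord) x *
      ((f \o point_of (chart_at a)) \o xcoord) x)).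
    have S : smooth_on C ((f \o point_of (chart_at a)) \o xcoord).
      apply: (smooth_on_sub _ (smooth_on_space (pfun_smooth f a))).
      by move=> x [].
    by apply: smooth_onN => //; exact: smooth_onM.
  by apply/funext => x; rewrite block_mxEul !ord1 mxE eqxx mulr1n expr2.
- rewrite (_ : (fun x => _) = fun=> 0); first exact: smooth_on_cst.
  by apply/funext => x; rewrite block_mxEur mxE.
- rewrite (_ : (fun x => _) = fun=> 0); first exact: smooth_on_cst.
  by apply/funext => x; rewrite block_mxEdl mxE.
- rewrite (_ : (fun x => _) = fun x => (s \o tcoord) x * (s \o tcoord) x *
      ((fun y => g a y k l) \o xcoord) x).
    have S : smooth_on C (s \o tcoord).
      apply: (@smooth_on_sub _ _ (tcoord @^-1` interval_set I) C _ _ (smooth_on_time (@psfun_smooth _ _ s))).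
      by move=> x [].
    apply: smooth_onM => //; first exact: smooth_onM.
    apply: (smooth_on_sub _ (smooth_on_space (@g_smooth _ _ _ g a k l))).
    by move=> x [].
  by apply/funext => x; rewrite block_mxEdr mxE expr2.
Qed.

Lemma warped_sym a x : cod (product_chart I (chart_at a)) x ->
  (warped_comp a x)^T = warped_comp a x.
Proof.
case=> _ cx; rewrite /warped_comp tr_block_mx !trmx0 tr_scalar_mx.
congr block_mx; apply/matrixP => i j; rewrite !mxE.
by rewrite -[in RHS](@g_sym _ _ _ g a _ cx) mxE.
Qed.

Lemma warped_nondegenerate a x : cod (product_chart I (chart_at a)) x ->
  warped_comp a x \in unitmx.
Proof.
case=> It cx; rewrite unitmxE det_ublock unitrM det_scalar1 detZ.
have f0 := pfun_gt0 f (point_of (chart_at a) (xcoord x)).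
have s0 := @psfun_gt0 _ _ s _ It.
have := g_nondegenerate g cx; rewrite unitmxE => g0.
apply/andP; split; first by rewrite unitrN unitrX// unitfE gt_eqF.
by rewrite (unitrM (_ ^+ n)) g0 andbT !unitrX// unitfE gt_eqF.
Qed.

Lemma warped_change a b x :
  overlap (product_chart I (chart_at a)) (product_chart I (chart_at b)) x ->
  warped_comp a x =
  jac (transition (product_chart I (chart_at a)) (product_chart I (chart_at b))) x
    *m warped_comp b (transition (product_chart I (chart_at a))
                                 (product_chart I (chart_at b)) x)
    *m (jac (transition (product_chart I (chart_at a))
                        (product_chart I (chart_at b))) x)^T.
Proof.
move=> Ox; rewrite jac_transition_product//.
move: Ox; rewrite overlap_product => -[It Oy].
rewrite transition_product// /warped_comp time_row space_row.
have -> : point_of (chart_at b) (transition (chart_at a) (chart_at b) (xcoord x))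
  = point_of (chart_at a) (xcoord x) by rewrite /transition coord_ofK//; case: Oy.
rewrite tr_block_mx !trmx0 tr_scalar_mx !mulmx_block.
rewrite !(mul0mx, mulmx0, mul1mx, mulmx1, addr0, add0r).
by rewrite -scalemxAr -scalemxAl -(g_change g Oy).
Qed.

Definition doubly_warped_metric : metric_tensor P :=
  @MetricTensor R (1 + n) P warped_comp warped_smooth warped_sym
    warped_nondegenerate warped_change.

End Metric.

Section Field.
Variables (h : smooth_fun_on I) (zeta : vector_field M).

(* [h d_t + zeta] *)
Definition sum_comp a x : 'rV[R]_(1 + n) :=
  row_mx (h (tcoord x))%:M (zeta a (xcoord x)).

Lemma sum_smooth a i :
  smooth_on (cod (product_chart I (chart_at a))) (fun x => sum_comp a x 0 i).
Proof.
set C := cod _; case: (split_ordP i) => k ->{i}.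
- rewrite (_ : (fun x => _) = h \o tcoord).
    apply: (@smooth_on_sub _ _ (tcoord @^-1` interval_set I) C _ _ (smooth_on_time (@sfun_smooth _ _ h))).
    by move=> x [].
  by apply/funext => x; rewrite /sum_comp row_mxEl ord1 mxE eqxx.
- rewrite (_ : (fun x => _) = (fun y => zeta a y 0 k) \o xcoord).
    apply: (smooth_on_sub _ (smooth_on_space (@vf_smooth _ _ _ zeta a k))).
    by move=> x [].
  by apply/funext => x; rewrite /sum_comp row_mxEr.
Qed.

Lemma sum_change a b x :
  overlap (product_chart I (chart_at a)) (product_chart I (chart_at b)) x ->
  sum_comp b (transition (product_chart I (chart_at a))
                         (product_chart I (chart_at b)) x) =
  sum_comp a x *m jac (transition (product_chart I (chart_at a))
                                  (product_chart I (chart_at b))) x.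
Proof.
move=> Ox; rewrite jac_transition_product//.
move: Ox; rewrite overlap_product => -[It Oy].
rewrite transition_product// /sum_comp time_row space_row.
rewrite mul_row_block !mulmx0 mulmx1 addr0 add0r.
by rewrite -(vf_change zeta Oy).
Qed.

Definition time_plus_lift : vector_field P :=
  @VectorField R (1 + n) P sum_comp sum_smooth sum_change.

End Field.

End DoublyWarped.

(* Main.v *)
(* With f = sigma = 1 the metric is, on every product chart, the direct sum of
   the constant form -dt^2 and g.  Hence a Christoffel symbol with an index in
   the time direction vanishes and the others are those of g, so that the Ricci
   tensor is 0 + Ric_g, while the Lie derivative along h d_t + zeta is
   -2 h' dt^2 + L_zeta g.  The time-time component of the soliton equation is
   then -h' = -lambda, and its spatial block is the equation on M. *)
Require Import Defs.
From mathcomp Require Import all_boot all_order all_algebra.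
From mathcomp Require Import all_classical all_reals all_analysis.
Import numFieldNormedType.Exports.
Import GRing.Theory Num.Theory.
Local Open Scope ring_scope.

(** * Locality of Ricci curvature and of the Lie derivative in the metric *)

Section Locality.
Context {R : realType} {n : nat} {U : set 'rV[R]_n}.
Hypothesis oU : open U.
Implicit Types (F : 'rV[R]_n -> R) (G : 'rV[R]_n -> 'M[R]_n).

(** A directional derivative is a limit at [x], so it sees only values near [x], and the open set
    [U] is a neighbourhood of each of its points. *)
Lemma eq_partial i F F' : {in U, F =1 F'} -> {in U, partial i F =1 partial i F'}.
Proof.
move=> FF x; rewrite inE => Ux.
by apply: near_eq_derive; exact: near_open_eq oU FF Ux.
Qed.

Lemma eq_partial_entry i G G' j k : {in U, G =1 G'} ->
  {in U, partial i (fun y => G y j k) =1 partial i (fun y => G' y j k)}.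
Proof. by move=> GG; apply: eq_partial => x Ux; rewrite GG. Qed.

Lemma eq_christoffel G G' k i j : {in U, G =1 G'} ->
  {in U, christoffel G k i j =1 christoffel G' k i j}.
Proof.
move=> GG x Ux; rewrite /christoffel GG//; congr (_ * _).
by apply: eq_bigr => l _; rewrite !(eq_partial_entry _ _ _ _ _ GG _ Ux).
Qed.

(** Christoffel symbols get differentiated here, so their agreement is used on all of [U] and not
    just at [x]. *)
Lemma eq_ricci G G' : {in U, G =1 G'} -> {in U, ricci G =1 ricci G'}.
Proof.
move=> GG x Ux; apply/matrixP => j k; rewrite !mxE; apply: eq_bigr => i _.
have CC p q r := eq_christoffel _ _ p q r GG.
rewrite /riemann !(eq_partial _ _ _ (CC _ _ _) _ Ux); congr (_ + _).
by apply: eq_bigr => m _; rewrite !(CC _ _ _ _ Ux).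
Qed.

Lemma eq_lie_derivative X G G' : {in U, G =1 G'} ->
  {in U, lie_derivative X G =1 lie_derivative X G'}.
Proof.
move=> GG x Ux; apply/matrixP => i j; rewrite !mxE; apply: eq_bigr => k _.
by rewrite (eq_partial_entry _ _ _ _ _ GG _ Ux) GG.
Qed.

End Locality.

(* No invertibility of [D] is required: [invmx] is the identity on singular
   matrices, and [-1] is its own inverse. *)
Lemma invmx_opp1_block (F : comUnitRingType) (m n : nat) (D : 'M[F]_n) :
  invmx (block_mx (- 1)%:M 0 0 D) = block_mx (- 1)%:M 0 0 (invmx D) :> 'M[F]_(m + n).
Proof.
have uN1 : (- 1)%:M \in @unitmx F m.
  by rewrite unitmxE det_scalar unitrX// unitrN1.
have uE : (block_mx (- 1)%:M 0 0 D \in @unitmx F (m + n)) = (D \in unitmx).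
  by rewrite [LHS]unitmxE det_ublock unitrM -!unitmxE uN1.
have [uD|nuD] := boolP (D \in unitmx).
  by rewrite invmx_block_diag ?uE// invmx_scalar invrN1.
by rewrite [LHS]invmx_out ?invmx_out ?inE ?uE.
Qed.

(** * Christoffel symbols and Ricci tensor after adding a time direction *)

Section ProductWithTime.
Context {R : realType} {n : nat}.
Variables (G : 'rV[R]_n -> 'M[R]_n) (s : R -> R) (X : 'rV[R]_n -> 'rV[R]_n).
Implicit Type x : 'rV[R]_(1 + n).

Let Gbar x : 'M[R]_(1 + n) := block_mx (- 1)%:M 0 0 (G (xcoord x)).
Let Xbar x : 'rV[R]_(1 + n) := row_mx (s (tcoord x))%:M (X (xcoord x)).

Let partial0 (i : 'I_(1 + n)) x : partial i (fun=> 0 : R) x = 0.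
Proof. exact: derive_cst. Qed.

Let Gbar_ll i j x : Gbar x (lshift n i) (lshift n j) = - 1.
Proof. by rewrite block_mxEul !ord1 mxE eqxx. Qed.

Let Gbar_lr i j x : Gbar x (lshift n i) (rshift 1 j) = 0.
Proof. by rewrite block_mxEur mxE. Qed.

Let Gbar_rl i j x : Gbar x (rshift 1 i) (lshift n j) = 0.
Proof. by rewrite block_mxEdl mxE. Qed.

Let Gbar_rr i j x : Gbar x (rshift 1 i) (rshift 1 j) = G (xcoord x) i j.
Proof. by rewrite block_mxEdr. Qed.

Let GbarE := (Gbar_ll, Gbar_lr, Gbar_rl, Gbar_rr).

Let partial_Gbar_ll k i j x :
  partial k (fun y => Gbar y (lshift n i) (lshift n j)) x = 0.
Proof. by rewrite (funext (Gbar_ll i j)); exact: derive_cst. Qed.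

Let partial_Gbar_lr k i j x :
  partial k (fun y => Gbar y (lshift n i) (rshift 1 j)) x = 0.
Proof. by rewrite (funext (Gbar_lr i j)) partial0. Qed.

Let partial_Gbar_rl k i j x :
  partial k (fun y => Gbar y (rshift 1 i) (lshift n j)) x = 0.
Proof. by rewrite (funext (Gbar_rl i j)) partial0. Qed.

Let partial_Gbar_rrl k i j x :
  partial (lshift n k) (fun y => Gbar y (rshift 1 i) (rshift 1 j)) x = 0.
Proof.
by rewrite (funext (Gbar_rr i j)) ord1 (partial_space_l (fun y => G y i j) x).2.
Qed.

Let partial_Gbar_rrr k i j x :
  partial (rshift 1 k) (fun y => Gbar y (rshift 1 i) (rshift 1 j)) x =
  partial k (fun y => G y i j) (xcoord x).
Proof.
by rewrite (funext (Gbar_rr i j)) (partial_space_r (fun y => G y i j) k x).2.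
Qed.

Let partial_GbarE := (partial_Gbar_ll, partial_Gbar_lr, partial_Gbar_rl,
  partial_Gbar_rrl, partial_Gbar_rrr).

(** With a block diagonal inverse, one half always drops out: the sum over space for an upper time
    index, the isolated term for an upper space index. *)
Let christoffel_product_split k i j x :
  christoffel Gbar k i j x = 2^-1 *
   (invmx (Gbar x) k (lshift n 0) *
    (partial i (fun y => Gbar y j (lshift n 0)) x
     + partial j (fun y => Gbar y i (lshift n 0)) x
     - partial (lshift n 0) (fun y => Gbar y i j) x)
   + \sum_l invmx (Gbar x) k (rshift 1 l) *
    (partial i (fun y => Gbar y j (rshift 1 l)) x
     + partial j (fun y => Gbar y i (rshift 1 l)) x
     - partial (rshift 1 l) (fun y => Gbar y i j) x)).
Proof. by rewrite /christoffel big_split_ord big_ord1. Qed.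

Let christoffel_rrr k i j :
  christoffel Gbar (rshift 1 k) (rshift 1 i) (rshift 1 j) =
  christoffel G k i j \o xcoord.
Proof.
apply/funext => x; rewrite christoffel_product_split /Gbar invmx_opp1_block.
rewrite block_mxEdl mxE mul0r add0r; congr (_ * _).
by apply: eq_bigr => l _; rewrite block_mxEdr !partial_GbarE.
Qed.

(** What survives are derivatives of entries with a time index, which are constant, and a time
    derivative of [Gbar], which is static. Equality as functions lets [partial0] erase derivatives
    of the symbol later. *)
Let christoffel_l i j k :
  christoffel Gbar (lshift n k) i j = fun=> 0.
Proof.
apply/funext => x; rewrite christoffel_product_split big1 => [|l _]; last first.
  by rewrite /Gbar invmx_opp1_block block_mxEur mxE mul0r.
case: (split_ordP i) => i' ->; case: (split_ordP j) => j' ->;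
by rewrite !partial_GbarE !(addr0, subr0, mulr0).
Qed.

Let christoffel_rl k i j :
  christoffel Gbar k (lshift n i) j = fun=> 0.
Proof.
case: (split_ordP k) => k' ->; first exact: christoffel_l.
apply/funext => x; rewrite christoffel_product_split big1 => [|l _].
  by rewrite /Gbar invmx_opp1_block block_mxEdl mxE mul0r addr0 mulr0.
case: (split_ordP j) => j' ->;
by rewrite !partial_GbarE !(addr0, subr0, mulr0).
Qed.

Let christoffel_rr k i j :
  christoffel Gbar k i (lshift n j) = fun=> 0.
Proof.
case: (split_ordP k) => k' ->; first exact: christoffel_l.
case: (split_ordP i) => i' ->; first exact: christoffel_rl.
apply/funext => x; rewrite christoffel_product_split big1 => [|l _].
  by rewrite /Gbar invmx_opp1_block block_mxEdl mxE mul0r addr0 mulr0.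
by rewrite !partial_GbarE !(addr0, subr0, mulr0).
Qed.

Let christoffelE := (christoffel_l, christoffel_rl, christoffel_rr, christoffel_rrr).

Lemma ricci_product x :
  ricci Gbar x = block_mx 0 0 0 (ricci G (xcoord x)).
Proof.
apply/matrixP => j k; rewrite mxE big_split_ord /= big_ord1.
(* The time term of the trace vanishes: each of its derivatives and products involves a symbol with
   upper time index. *)
rewrite {1}/riemann !christoffelE !partial0 subrr add0r big1 ?add0r; last first.
  by move=> m _; rewrite !christoffelE !mul0r subrr.
case: (split_ordP j) => j' ->; case: (split_ordP k) => k' ->.
- rewrite block_mxEul mxE big1// => i _.
  rewrite /riemann !christoffelE !partial0 subrr add0r big1// => m _.
  by rewrite !christoffelE !mulr0 subrr.
- rewrite block_mxEur mxE big1// => i _.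
  rewrite /riemann !christoffelE !partial0.
  (* The one symbol left is pulled back from space, so its time derivative is zero. *)
  rewrite ord1 (partial_space_l (christoffel G i i k') x).2.
  rewrite subr0 add0r big1// => m _.
  by rewrite !christoffelE !mulr0 !mul0r subrr.
- rewrite block_mxEdl mxE big1// => i _.
  rewrite /riemann !christoffelE !partial0 subrr add0r big1// => m _.
  by rewrite !christoffelE !mulr0 subrr.
- rewrite block_mxEdr mxE; apply: eq_bigr => i _.
  rewrite /riemann !christoffelE !partial_space_r; congr (_ + _).
  (* The contracted index [m] also takes the time value, which contributes nothing. *)
  rewrite big_split_ord /= big_ord1 !christoffelE !mul0r subrr add0r.
  by apply: eq_bigr => m _; rewrite !christoffelE.
Qed.

(** * Lie derivative along the sum of a time field and a space field *)

Let Xbar_l i : (fun y => Xbar y 0 (lshift n i)) = s \o tcoord.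
Proof. by apply/funext => y; rewrite row_mxEl ord1 mxE eqxx. Qed.

Let Xbar_r i : (fun y => Xbar y 0 (rshift 1 i)) = (fun y => X y 0 i) \o xcoord.
Proof. by apply/funext => y; rewrite row_mxEr. Qed.

Let partial_Xbar_ll k i x :
  partial (lshift n k) (fun y => Xbar y 0 (lshift n i)) x = derive1 s (tcoord x).
Proof. by rewrite Xbar_l ord1 partial_time_l. Qed.

Let partial_Xbar_rl k i x :
  partial (rshift 1 k) (fun y => Xbar y 0 (lshift n i)) x = 0.
Proof. by rewrite Xbar_l (partial_time_r s k x).2. Qed.

Let partial_Xbar_lr k i x :
  partial (lshift n k) (fun y => Xbar y 0 (rshift 1 i)) x = 0.
Proof. by rewrite Xbar_r ord1 (partial_space_l (fun y => X y 0 i) x).2. Qed.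

Let partial_Xbar_rr k i x :
  partial (rshift 1 k) (fun y => Xbar y 0 (rshift 1 i)) x =
  partial k (fun y => X y 0 i) (xcoord x).
Proof. by rewrite Xbar_r partial_space_r. Qed.

Let partial_XbarE := (partial_Xbar_ll, partial_Xbar_lr, partial_Xbar_rl,
  partial_Xbar_rr).

(** Time and space components of [Xbar] each depend on their own variables only, which kills the
    mixed blocks. The factor [- 2] collects the two terms that pair the entry [- 1] with the
    derivative of [s]. *)
Lemma lie_derivative_product x :
  lie_derivative Xbar Gbar x =
  block_mx (- 2 * derive1 s (tcoord x))%:M 0 0 (lie_derivative X G (xcoord x)).
Proof.
apply/matrixP => i j; rewrite mxE big_split_ord /= big_ord1.
case: (split_ordP i) => i' ->; case: (split_ordP j) => j' ->.
- rewrite block_mxEul !ord1 [RHS]mxE eqxx big1 => [|k _].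
    by rewrite !GbarE !partial_GbarE !partial_XbarE mulr0 add0r addr0
      mulr1n mulNr mulN1r mulr2n mulrDl mul1r opprD.
  by rewrite !GbarE !partial_GbarE mulr0 !mul0r !addr0.
- rewrite block_mxEur [RHS]mxE big1 => [|k _].
    by rewrite !GbarE !partial_GbarE !partial_XbarE !mulr0 !mul0r !addr0.
  by rewrite !GbarE !partial_GbarE !partial_XbarE !mulr0 !mul0r !addr0.
- rewrite block_mxEdl [RHS]mxE big1 => [|k _].
    by rewrite !GbarE !partial_GbarE !partial_XbarE !mulr0 !mul0r !addr0.
  by rewrite !GbarE !partial_GbarE !partial_XbarE !mulr0 !mul0r !addr0.
- rewrite block_mxEdr [RHS]mxE !GbarE !partial_GbarE mulr0 !mul0r !addr0 add0r.
  by apply: eq_bigr => k _; rewrite !GbarE !partial_GbarE !partial_XbarE row_mxEr.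
Qed.

End ProductWithTime.

(** * The soliton equation, block by block *)

Theorem theorem16 (R : realType) (n : nat) (M : manifold R n)
    (g : metric_tensor M) (I : open_interval R)
    (f : pos_smooth_fun M) (sigma : pos_smooth_fun_on I)
    (h : smooth_fun_on I) (zeta : vector_field M) (lambda : R) :
  riemannian g ->
  (forall t : R, interval_set I t -> ricci_soliton g zeta (derive1 h t)) ->
  (forall p : M, f p = 1) /\ (forall t : R, interval_set I t -> sigma t = 1) ->
  (forall t : R, interval_set I t -> lambda = derive1 h t) ->
  ricci_soliton (doubly_warped_metric f sigma g) (time_plus_lift h zeta) lambda.
Proof.
move=> _ solM [f1 s1] lamE a x Ux; have [It cx] := Ux.
set c := product_chart I (chart_at (a : atlas M)).
have oU : open (cod c) by exact: cod_open.
(* This holds only on the chart's image, since [sigma] is arbitrary outside the interval; the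
   locality lemmas bridge the gap. *)
have GE : {in cod c,
    warped_comp f sigma g a =1
    fun y => block_mx (- 1)%:M 0 0 (g a (xcoord y))}.
  move=> y; rewrite inE => -[Jt _].
  by rewrite /warped_comp f1 s1// !expr1n scale1r.
have Ux' : x \in cod c by rewrite inE.
rewrite /= (eq_lie_derivative oU _ _ _ GE _ Ux') (eq_ricci oU _ _ GE _ Ux').
rewrite (GE _ Ux') ricci_product lie_derivative_product.
rewrite !scale_block_mx add_block_mx !scaler0 !addr0 !scale_scalar_mx.
(* In the space block, the soliton equation on [M] is taken at the time coordinate of [x]. *)
congr block_mx; last by rewrite (lamE _ It); exact: solM.
by rewrite -(lamE _ It) mulNr mulrN mulKf ?pnatr_eq0// mulrN1.
Qed.
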